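(* Let $\Gamma_1$ be a lattice in $\mathbb{R}^d$ having $\Gamma_2$ as a sublattice of index $m$, let $R\in OC(\Gamma_1)$, and let $\Sigma_i(R)$ be the coincidence index of $R$ with respect to $\Gamma_i$, for $i=1,2$. Let $s:=[\Gamma_1(R):R\Gamma_2\cap\Gamma_1(R)]$ and $t:=[\Gamma_1(R):\Gamma_2\cap\Gamma_1(R)]$. 1. If $R$ is a colour coincidence of the colouring of $\Gamma_1$ determined by $\Gamma_2$, then $\Sigma_2(R)\mid\Sigma_1(R)$. 2. If $s=t=m$, then $R$ is a colour coincidence of the colouring of $\Gamma_1$ determined by $\Gamma_2$ if and only if $\Sigma_2(R)=\Sigma_1(R)$.
   Context: A lattice $\Gamma$ in $\mathbb{R}^d$ is the $\mathbb{Z}$-span of $d$ vectors that are linearly independent over $\mathbb{R}$. A sublattice of $\Gamma$ is a subgroup of $\Gamma$ of finite index. For $R\in O(d)$ put $\Gamma(R):=\Gamma\cap R\Gamma$ (so $\Gamma(R^{-1})=\Gamma\cap R^{-1}\Gamma$). An $R\in O(d)$ is a coincidence isometry of $\Gamma$ if $\Gamma(R)$ is a sublattice of $\Gamma$ (i.e. has finite index in $\Gamma$); in that case the coincidence index of $R$ with respect to $\Gamma$ is $\Sigma(R):=[\Gamma:\Gamma(R)]=[R\Gamma:\Gamma(R)]$. The set of coincidence isometries of $\Gamma$ is a group, denoted $OC(\Gamma)$. If $\Gamma_2$ is a sublattice of $\Gamma_1$, then $OC(\Gamma_1)=OC(\Gamma_2)$ (known fact), so $\Sigma_1(R)=[\Gamma_1:\Gamma_1(R)]$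 and $\Sigma_2(R)=[\Gamma_2:\Gamma_2(R)]$ are both defined for $R\in OC(\Gamma_1)$. Note that $R[\Gamma_1(R^{-1})]=\Gamma_1(R)$. The colouring of $\Gamma_1$ determined by $\Gamma_2$ assigns a distinct colour to each coset of $\Gamma_2$ in $\Gamma_1=\bigcup_{i=1}^m(c_i+\Gamma_2)$, with $c_1=0$. Let $I:=\{c_i+\Gamma_2:(c_i+\Gamma_2)\cap\Gamma_1(R^{-1})\neq\emptyset\}$ and $J:=\{c_j+\Gamma_2:(c_j+\Gamma_2)\cap\Gamma_1(R)\neq\emptyset\}$. An $R\in OC(\Gamma_1)$ is called a colour coincidence of the colouring of $\Gamma_1$ determined by $\Gamma_2$ if $R$ defines a bijection between the partition $\{(c_i+\Gamma_2)\cap\Gamma_1(R^{-1}):c_i+\Gamma_2\in I\}$ of $\Gamma_1(R^{-1})$ and the partition $\{(c_j+\Gamma_2)\cap\Gamma_1(R):c_j+\Gamma_2\in J\}$ of $\Gamma_1(R)$, given by $R[(c_i+\Gamma_2)\cap\Gamma_1(R^{-1})]=(c_j+\Gamma_2)\cap\Gamma_1(R)$; that is, the image under $R$ of each block of the first partition is a block of the second, and this correspondence of blocks is a bijection. *)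

(* Defs.v *)
(* MathComp / MathComp-Analysis; R^d is 'cV[R]_d over a realType R. *)
From HB Require Import structures.
From mathcomp Require Import all_boot all_order all_algebra finmap.
From mathcomp Require Import boolp classical_sets functions cardinality reals.

Set Implicit Arguments.
Unset Strict Implicit.
Unset Printing Implicit Defensive.

Import GRing.Theory Num.Theory.
Local Open Scope classical_set_scope.
Local Open Scope ring_scope.

Definition coset (V : zmodType) (H : set V) (c : V) : set V :=
  [set c + h | h in H].

Definition cosets (V : zmodType) (G H : set V) : set (set V) :=
  [set coset H c | c in G].

(* [G : H] for a subgroup H of G. By the convention of fset_set the value is
   0 when there are infinitely many cosets; a finite index is at least 1. *)
Definition subgroup_index (V : zmodType) (G H : set V) : nat :=
  #|` fset_set (cosets G H)|%fset.

Definition sublattice_of (V : zmodType) (H G : set V) : Prop :=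
  [/\ zmod_closed (mem H), H `<=` G & finite_set (cosets G H)].

Definition lattice (R : realType) (d : nat) (G : set 'cV[R]_d) : Prop :=
  exists2 b : d.-tuple 'cV[R]_d, free b &
    G = [set v | exists z : 'I_d -> int, v = \sum_(i < d) tnth b i *~ z i].

Definition orthogonal_mx (R : realType) (d : nat) (Q : 'M[R]_d) : Prop :=
  Q^T *m Q = 1%:M.

Definition mximage (R : realType) (d : nat) (Q : 'M[R]_d) (G : set 'cV[R]_d) :
  set 'cV[R]_d := [set Q *m v | v in G].

(* Gamma(Q) = Gamma `&` Q Gamma *)
Definition csl (R : realType) (d : nat) (G : set 'cV[R]_d) (Q : 'M[R]_d) :
  set 'cV[R]_d := G `&` mximage Q G.

Definition OC (R : realType) (d : nat) (G : set 'cV[R]_d) : set 'M[R]_d :=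
  [set Q | orthogonal_mx Q /\ sublattice_of (csl G Q) G].

Definition Sigma (R : realType) (d : nat) (G : set 'cV[R]_d) (Q : 'M[R]_d) :
  nat := subgroup_index G (csl G Q).

(* The colours of the colouring of G1 determined by G2 are the cosets of G2 in
   G1; colours_on G1 G2 L collects those occurring on L. *)
Definition colours_on (V : zmodType) (G1 G2 L : set V) : set (set V) :=
  [set C | cosets G1 G2 C /\ C `&` L !=set0].

Definition colour_partition (V : zmodType) (G1 G2 L : set V) : set (set V) :=
  [set C `&` L | C in colours_on G1 G2 L].

Definition colour_coincidence (R : realType) (d : nat)
    (G1 G2 : set 'cV[R]_d) (Q : 'M[R]_d) : Prop :=
  OC G1 Q /\
  set_bij (colour_partition G1 G2 (csl G1 (invmx Q)))
          (colour_partition G1 G2 (csl G1 Q))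
          (mximage Q).

(* Main.v *)
(* Put L := G1(Q) and K := G2 ∩ Q G2 = (G2 ∩ L) ∩ (Q G2 ∩ L). The blocks of the
   colouring on L are the cosets of G2 ∩ L in L, and Q carries the blocks on
   G1(Q^-1) to the cosets of Q G2 ∩ L in L. Two subgroups with the same cosets
   agree, so Q is a colour coincidence iff G2 ∩ L = Q G2 ∩ L, in which case both
   equal K. Multiplicativity of the index gives
   [G1 : L] [L : K] = [G1 : G2] [G2 : K], where [L : G2 ∩ L] = [L + G2 : G2]
   divides m. *)
Require Import Defs.
From mathcomp Require Import all_boot all_order all_algebra finmap.
From mathcomp Require Import boolp classical_sets functions cardinality reals.

Set Implicit Arguments.
Unset Strict Implicit.
Unset Printing Implicit Defensive.

Import GRing.Theory.
Local Open Scope classical_set_scope.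
Local Open Scope ring_scope.

Lemma cardfsM (T U : choiceType) (A : {fset T}) (B : {fset U}) :
  #|` A `*` B|%fset = (#|` A|%fset * #|` B|%fset)%N.
Proof.
rewrite -(size_allpairs pair); apply/perm_size/uniq_perm => //.
  by apply: allpairs_uniq => // -[x y] [x' y'].
move=> [x y]; rewrite in_fsetM /=.
by apply/andP/allpairsP => [[Ax By]|[[x' y'] [Ax By [-> ->]]]]; [exists (x, y)|].
Qed.

(** * Subgroups of an abelian group and their cosets *)

Section SubgroupIndex.
Variable V : zmodType.
Implicit Types (A B G H K L M : set V) (x y : V).

Lemma zmod_closed_setP H :
  zmod_closed (mem H) <-> H 0 /\ forall x y, H x -> H y -> H (x - y).
Proof.
split=> -[H0 HB]; split.
- exact: set_mem H0.
- by move=> x y /mem_set Hx /mem_set Hy; apply/set_mem/HB.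
- exact: mem_set H0.
- by move=> x y /set_mem Hx /set_mem Hy; apply/mem_set/HB.
Qed.

Lemma zmod_closed0 H : zmod_closed (mem H) -> H 0.
Proof. by case/zmod_closed_setP. Qed.

Lemma zmod_closedB H x y : zmod_closed (mem H) -> H x -> H y -> H (x - y).
Proof. by case/zmod_closed_setP=> _; apply. Qed.

Lemma zmod_closedN H x : zmod_closed (mem H) -> H x -> H (- x).
Proof.
by move=> hH Hx; rewrite -sub0r; apply: zmod_closedB => //; apply: zmod_closed0.
Qed.

Lemma zmod_closedD H x y : zmod_closed (mem H) -> H x -> H y -> H (x + y).
Proof.
by move=> hH Hx Hy; rewrite -[y]opprK; apply: zmod_closedB => //;
   apply: zmod_closedN.
Qed.

Lemma zmod_closedI H K : zmod_closed (mem H) -> zmod_closed (mem K) ->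
  zmod_closed (mem (H `&` K)).
Proof.
move=> hH hK; apply/zmod_closed_setP; split; first by split; apply: zmod_closed0.
by move=> x y [? ?] [? ?]; split; apply: zmod_closedB.
Qed.

Lemma zmod_closed_add H K : zmod_closed (mem H) -> zmod_closed (mem K) ->
  zmod_closed (mem [set x + y | x in H & y in K]).
Proof.
move=> hH hK; apply/zmod_closed_setP; split.
  by exists 0; [exact: zmod_closed0|exists 0; [exact: zmod_closed0|rewrite addr0]].
move=> _ _ [x Hx [y Ky <-]] [x' Hx' [y' Ky' <-]].
exists (x - x'); first exact: zmod_closedB.
by exists (y - y'); [exact: zmod_closedB|rewrite opprD addrACA].
Qed.

Lemma cosetE H x y : coset H x y <-> H (y - x).
Proof.
split; first by case=> h Hh <-; rewrite addrC addKr.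
by move=> h; exists (y - x) => //; rewrite addrC subrK.
Qed.

Lemma coset_id H x : zmod_closed (mem H) -> coset H x x.
Proof. by move=> hH; apply/cosetE; rewrite subrr; apply: zmod_closed0. Qed.

Lemma coset_eqP H x y : zmod_closed (mem H) ->
  coset H x = coset H y <-> H (x - y).
Proof.
move=> hH; split=> [e|Hxy].
  by apply/cosetE; rewrite -e; apply: coset_id.
apply/seteqP; split=> z /cosetE Hz; apply/cosetE.
  by rewrite -(subrK x z) -addrA; apply: zmod_closedD.
by rewrite -(subrK y z) -addrA -(opprB x y); apply: zmod_closedB.
Qed.

Lemma coset0 H : coset H 0 = H.
Proof.
by apply/seteqP; split=> z; [move/cosetE|move=> ?; apply/cosetE]; rewrite subr0.
Qed.

(** A representative picked by choice. The default [0] is returned only for an empty set, and a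
    coset of a subgroup is never empty. *)
Definition coset_repr (C : set V) : V := xget 0 C.

Lemma coset_reprP H x : zmod_closed (mem H) -> coset H x (coset_repr (coset H x)).
Proof. by move=> hH; apply: (@xgetPex _ 0); exists x; apply: coset_id. Qed.

Lemma coset_reprK H x : zmod_closed (mem H) ->
  coset H (coset_repr (coset H x)) = coset H x.
Proof. by move=> hH; apply/coset_eqP => //; apply/cosetE/coset_reprP. Qed.

Lemma coset_repr_in G H x : zmod_closed (mem G) -> zmod_closed (mem H) ->
  H `<=` G -> G x -> G (coset_repr (coset H x)).
Proof.
move=> hG hH HG Gx; have /cosetE/HG Gr := coset_reprP x hH.
by rewrite -(subrK x (coset_repr _)); apply: zmod_closedD.
Qed.

(** A subgroup is the only one of its cosets that contains [0]: [H] occurs among the cosets of [K]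
    and contains [0], so it is [K] itself. *)
Lemma coset_subgroup_inj L H K : zmod_closed (mem L) ->
  zmod_closed (mem H) -> zmod_closed (mem K) ->
  cosets L H = cosets L K -> H = K.
Proof.
move=> hL hH hK e.
have : cosets L K H.
  by rewrite -e; exists 0; [exact: zmod_closed0|exact: coset0].
case=> x Lx eK; rewrite -eK.
have /cosetE : coset K x 0 by rewrite eK; apply: zmod_closed0.
rewrite sub0r => /zmod_closedN -/(_ hK); rewrite opprK => Kx.
by rewrite -[RHS]coset0; apply/coset_eqP; rewrite ?subr0.
Qed.

(** * Towers of subgroups and multiplicativity of the index *)

Lemma cosetsS G G' H : G `<=` G' -> cosets G H `<=` cosets G' H.
Proof. by move=> GG' _ [x Gx <-]; exists x => //; apply: GG'. Qed.

(** The transversal map from G/H x H/K to G/K. It depends on the chosen representatives and is used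
    only as a bijection of sets. *)
Definition coset_sum K (p : set V * set V) : set V :=
  coset K (coset_repr p.1 + coset_repr p.2).

Lemma cosets_tower G H K : zmod_closed (mem G) ->
  zmod_closed (mem H) -> zmod_closed (mem K) -> K `<=` H -> H `<=` G ->
  cosets G K = coset_sum K @` (cosets G H `*` cosets H K).
Proof.
move=> hG hH hK KH HG; apply/seteqP; split=> [_ [x Gx <-]|_ [[_ _] [/= [x Gx <-] [y Hy <-]] <-]].
  (* Write [x] as r + (x - r), with r the representative of its [H]-coset; then x - r lies in
     [H]. *)
  exists (coset H x, coset K (x - coset_repr (coset H x))); first split => /=.
  - by exists x.
  - exists (x - coset_repr (coset H x)) => //.
    by apply/coset_eqP; rewrite ?coset_reprK.
  - apply/coset_eqP => //=.
    have /cosetE := coset_reprP (x - coset_repr (coset H x)) hK.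
    by rewrite opprB addrCA addrA.
exists (coset_repr (coset H x) + coset_repr (coset K y)) => //.
apply: zmod_closedD => //; first exact: coset_repr_in.
by apply: HG; apply: coset_repr_in.
Qed.

(** The second representative lies in [H], so reduction modulo [H] recovers the first coset. The
    first representatives then cancel, and the second ones agree modulo [K]. *)
Lemma coset_sum_inj G H K : zmod_closed (mem H) -> zmod_closed (mem K) ->
  K `<=` H -> set_inj (cosets G H `*` cosets H K) (coset_sum K).
Proof.
move=> hH hK KH p q /set_mem[/= [x _ ex] [y Hy ey]].
move=> /set_mem[/= [x' _ ex'] [y' Hy' ey']] /coset_eqP -/(_ hK).
case: p ex ey => _ _ /= <- <-; case: q ex' ey' => _ _ /= <- <- Kd.
have Hr z : H z -> H (coset_repr (coset K z)) by apply: coset_repr_in.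
have exx' : coset H x = coset H x'.
  rewrite -coset_reprK // -[RHS]coset_reprK //; apply/coset_eqP => //.
  move: Kd; rewrite opprD addrACA => /KH Hd; move: (Hr y Hy) (Hr y' Hy').
  by move=> ry ry'; have := zmod_closedB hH Hd (zmod_closedB hH ry ry'); rewrite addrK.
rewrite exx'; congr pair; rewrite -coset_reprK // -[RHS]coset_reprK //.
apply/coset_eqP => //; move: Kd; rewrite exx' opprD addrACA subrr add0r.
exact: id.
Qed.

Lemma finite_cosets_tower G H K : zmod_closed (mem G) ->
  zmod_closed (mem H) -> zmod_closed (mem K) -> K `<=` H -> H `<=` G ->
  finite_set (cosets G H) -> finite_set (cosets H K) ->
  finite_set (cosets G K).
Proof.
move=> hG hH hK KH HG fGH fHK.
by rewrite (cosets_tower hG hH) //; apply/finite_image/finite_setX.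
Qed.

(** Each coset of [K] lies in a single coset of [H], which maps G/K onto G/H. *)
Lemma finite_cosets_over G H K : zmod_closed (mem G) ->
  zmod_closed (mem H) -> zmod_closed (mem K) -> K `<=` H ->
  finite_set (cosets G K) -> finite_set (cosets G H).
Proof.
move=> hG hH hK KH fGK.
suff -> : cosets G H = (fun C => coset H (coset_repr C)) @` cosets G K.
  exact: finite_image.
have e x : coset H (coset_repr (coset K x)) = coset H x.
  by apply/coset_eqP => //; apply/KH/cosetE/coset_reprP.
apply/seteqP; split=> [_ [x Gx <-]|_ [_ [x Gx <-] <-]].
  by exists (coset K x); [exists x|exact: e].
by exists x; rewrite ?e.
Qed.

Lemma subgroup_index_tower G H K : zmod_closed (mem G) ->
  zmod_closed (mem H) -> zmod_closed (mem K) -> K `<=` H -> H `<=` G ->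
  finite_set (cosets G K) ->
  subgroup_index G K = (subgroup_index G H * subgroup_index H K)%N.
Proof.
move=> hG hH hK KH HG fGK.
(* An infinite coset family would have index 0 by convention, so both factors are first shown to be
   finite. *)
have fGH := finite_cosets_over hG hH hK KH fGK.
have fHK := sub_finite_set (@cosetsS _ _ K HG) fGK.
rewrite /subgroup_index -cardfsM -fset_setX //.
apply/fcard_eq => //; first exact: finite_setX.
rewrite (cosets_tower hG hH) //.
by apply: inj_card_eq => p q; apply: coset_sum_inj.
Qed.

Lemma subgroup_index_gt0 G H : zmod_closed (mem G) ->
  finite_set (cosets G H) -> (0 < subgroup_index G H)%N.
Proof.
move=> hG fGH; rewrite cardfs_gt0; apply/fset0Pn; exists (coset H 0).
by rewrite in_fset_set //; apply/mem_set; exists 0 => //; apply: zmod_closed0.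
Qed.

Lemma subgroup_index_eq1 H K : zmod_closed (mem H) -> zmod_closed (mem K) ->
  K `<=` H -> finite_set (cosets H K) -> subgroup_index H K = 1%N -> K = H.
Proof.
move=> hH hK KH fHK /eqP/cardfs1P[C eC].
apply/seteqP; split=> // x Hx.
have inC y : H y -> coset K y = C.
  move=> Hy; apply/eqP; rewrite -(in_fset1) -eC in_fset_set //.
  by apply/mem_set; exists y.
rewrite -[x]subr0; apply/coset_eqP => //.
by rewrite !inC //; apply: zmod_closed0.
Qed.

(** By multiplicativity the positive factor [L : H] cancels and leaves [H : K] = 1. *)
Lemma subgroup_index_inj L H K : zmod_closed (mem L) ->
  zmod_closed (mem H) -> zmod_closed (mem K) -> K `<=` H -> H `<=` L ->
  finite_set (cosets L K) -> subgroup_index L K = subgroup_index L H -> K = H.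
Proof.
move=> hL hH hK KH HL fLK.
rewrite (subgroup_index_tower hL hH) // -[RHS]muln1 => /eqP.
rewrite eqn_pmul2l; last first.
  by apply: subgroup_index_gt0 => //; apply: finite_cosets_over fLK.
move=> /eqP; apply: subgroup_index_eq1 => //.
exact: sub_finite_set (@cosetsS _ _ K HL) fLK.
Qed.

(** The second isomorphism theorem on coset families: send x + (H ∩ L) to x + H. Differences of
    elements of [L] stay in [L], which gives injectivity; summands from [H] are absorbed, which
    gives surjectivity. *)
Lemma cosets_add_card_eq L H : zmod_closed (mem L) -> zmod_closed (mem H) ->
  (cosets [set x + y | x in L & y in H] H #= cosets L (H `&` L))%card.
Proof.
move=> hL hH; have hHL := zmod_closedI hH hL.
have e x : L x -> coset H (coset_repr (coset (H `&` L) x)) = coset H x.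
  by move=> Lx; apply/coset_eqP => //; have /cosetE[] := coset_reprP x hHL.
suff -> : cosets [set x + y | x in L & y in H] H =
    (fun C => coset H (coset_repr C)) @` cosets L (H `&` L).
  apply: inj_card_eq => _ _ /set_mem[x Lx <-] /set_mem[y Ly <-].
  rewrite !e // => /coset_eqP -/(_ hH) Hxy; apply/coset_eqP => //.
  by split=> //; apply: zmod_closedB.
apply/seteqP; split=> [_ [_ [x Lx [y Hy <-]] <-]|_ [_ [x Lx <-] <-]].
  exists (coset (H `&` L) x); first by exists x.
  by rewrite e //; apply/coset_eqP; rewrite // opprD addNKr; apply: zmod_closedN.
exists x; last by rewrite e.
by exists x => //; exists 0; rewrite ?addr0 //; apply: zmod_closed0.
Qed.

Lemma finite_cosetsI G L H : zmod_closed (mem G) -> zmod_closed (mem L) ->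
  zmod_closed (mem H) -> L `<=` G -> H `<=` G -> finite_set (cosets G H) ->
  finite_set (cosets L (H `&` L)).
Proof.
move=> hG hL hH LG HG fGH.
rewrite -(eq_finite_set (cosets_add_card_eq hL hH)).
apply: sub_finite_set fGH; apply: cosetsS => _ [x Lx [y Hy <-]].
by apply: zmod_closedD => //; [apply: LG|apply: HG].
Qed.

(** Insert L + H between [H] and [G]: the index [L + H : H] is a factor of [G : H] and equals
    [L : H ∩ L]. *)
Lemma subgroup_indexI_dvd G L H : zmod_closed (mem G) -> zmod_closed (mem L) ->
  zmod_closed (mem H) -> L `<=` G -> H `<=` G -> finite_set (cosets G H) ->
  (subgroup_index L (H `&` L) %| subgroup_index G H)%N.
Proof.
move=> hG hL hH LG HG fGH; pose M := [set x + y | x in L & y in H].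
have MG : M `<=` G.
  move=> _ [x Lx [y Hy <-]].
  by apply: zmod_closedD => //; [apply: LG|apply: HG].
have HM : H `<=` M.
  by move=> y Hy; exists 0; [exact: zmod_closed0|exists y; rewrite ?add0r].
have hM : zmod_closed (mem M) by apply: zmod_closed_add.
rewrite (subgroup_index_tower hG hM) //.
suff -> : subgroup_index L (H `&` L) = subgroup_index M H by apply: dvdn_mull.
apply/esym/fcard_eq; last exact: cosets_add_card_eq.
  exact: sub_finite_set (@cosetsS _ _ H MG) fGH.
exact: finite_cosetsI fGH.
Qed.

(** A colour that meets [L] in [x] is the coset x + H, and its trace on [L] is x + (H ∩ L). *)
Lemma colour_partitionE G H L : zmod_closed (mem H) -> zmod_closed (mem L) ->
  L `<=` G -> colour_partition G H L = cosets L (H `&` L).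
Proof.
move=> hH hL LG.
have e x : L x -> coset H x `&` L = coset (H `&` L) x.
  move=> Lx; apply/seteqP; split=> y.
    by case=> /cosetE Hyx Ly; apply/cosetE; split=> //; apply: zmod_closedB.
  move=> /cosetE[Hyx Lyx]; split; first exact/cosetE.
  by rewrite -(subrK x y); apply: zmod_closedD.
apply/seteqP; split=> [_ [_ [[c Gc <-] [x [cx Lx]]] <-]|_ [x Lx <-]].
  exists x; rewrite // -e //; congr (_ `&` _).
  by apply/coset_eqP => //; apply/cosetE.
exists (coset H x); last exact: e.
split; first by exists x => //; apply: LG.
by exists x; split=> //; apply: coset_id.
Qed.

End SubgroupIndex.

(** * Images of subgroups under a matrix, and colour coincidences *)

Section MatrixImage.
Variables (R : realType) (d : nat).
Implicit Types (Q : 'M[R]_d) (G H L : set 'cV[R]_d).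

Lemma mximage_zmod_closed Q G :
  zmod_closed (mem G) -> zmod_closed (mem (mximage Q G)).
Proof.
move=> hG; apply/zmod_closed_setP; split.
  by exists 0; rewrite ?mulmx0 //; apply: zmod_closed0.
move=> _ _ [x Gx <-] [y Gy <-].
by exists (x - y); rewrite ?mulmxBr //; apply: zmod_closedB.
Qed.

Lemma mximage_coset Q H x : mximage Q (coset H x) = coset (mximage Q H) (Q *m x).
Proof.
apply/seteqP; split=> [_ [_ [h Hh <-] <-]|_ [_ [h Hh <-] <-]].
  by exists (Q *m h); rewrite ?mulmxDr //; exists h.
by exists (x + h); rewrite ?mulmxDr //; exists h.
Qed.

Lemma mximage_cosets Q G H :
  mximage Q @` cosets G H = cosets (mximage Q G) (mximage Q H).
Proof.
apply/seteqP; split=> [_ [_ [x Gx <-] <-]|_ [_ [x Gx <-] <-]].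
  by exists (Q *m x); [exists x|rewrite mximage_coset].
exists (coset H x); first by exists x.
exact: mximage_coset.
Qed.

Lemma mximageK Q : Q \in unitmx -> cancel (mximage (invmx Q)) (mximage Q).
Proof.
move=> uQ G; rewrite /mximage image_comp.
have -> : mulmx Q \o mulmx (invmx Q) = @id 'cV[R]_d.
  by apply/funext => x /=; rewrite mulKVmx.
exact: image_id.
Qed.

Lemma mximageVK Q : Q \in unitmx -> cancel (mximage Q) (mximage (invmx Q)).
Proof.
move=> uQ G; rewrite -[X in mximage X G]invmxK.
by apply: mximageK; rewrite unitmx_inv.
Qed.

Lemma mximageI Q G H : Q \in unitmx ->
  mximage Q (G `&` H) = mximage Q G `&` mximage Q H.
Proof.
move=> uQ; apply/seteqP; split=> [_ [x [Gx Hx] <-]|_ [[x Gx <-] [y Hy]]].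
  by split; exists x.
by move=> /(can_inj (mulKmx uQ)) yx; exists x; split=> //; rewrite -yx.
Qed.

Lemma orthogonal_unitmx Q : orthogonal_mx Q -> Q \in unitmx.
Proof. by case/mulmx1_unit. Qed.

(** An invertible [Q] is injective on blocks, so the bijection says only that two families of cosets
    in [csl G Q] coincide, and such a family determines its subgroup. *)
Lemma colour_coincidenceE G H Q :
  zmod_closed (mem G) -> zmod_closed (mem H) -> OC G Q ->
  colour_coincidence G H Q <->
  mximage Q H `&` csl G Q = H `&` csl G Q.
Proof.
move=> hG hH OCQ; have uQ := orthogonal_unitmx OCQ.1.
have hL P : zmod_closed (mem (csl G P)).
  by apply: zmod_closedI => //; apply: mximage_zmod_closed.
have QL : mximage Q (csl G (invmx Q)) = csl G Q.
  by rewrite mximageI // mximageK // setIC.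
have imE : mximage Q @` colour_partition G H (csl G (invmx Q)) =
    cosets (csl G Q) (mximage Q H `&` csl G Q).
  rewrite colour_partitionE //; last by move=> x [].
  by rewrite mximage_cosets (mximageI H) // QL.
have tE : colour_partition G H (csl G Q) = cosets (csl G Q) (H `&` csl G Q).
  by rewrite colour_partitionE // => x [].
have hQH := mximage_zmod_closed Q hH.
split=> [[_ [sub _ sur]]|e].
  apply: (@coset_subgroup_inj _ (csl G Q)); rewrite -?imE -?tE //;
    try exact: zmod_closedI.
  by apply/seteqP; split=> [_ [C PC <-]|C PC]; [exact: sub|exact: sur].
split=> //; rewrite /set_bij /set_surj tE -e -imE; split=> //.
by move=> C D _ _ /(can_inj (mximageVK uQ)).
Qed.

Lemma lattice_zmod_closed G : lattice G -> zmod_closed (mem G).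
Proof.
case=> b _ ->; apply/zmod_closed_setP; split.
  by exists (fun=> 0); rewrite big1 // => i _; rewrite mulr0z.
move=> _ _ [z ->] [w ->]; exists (fun i => z i - w i).
by rewrite -sumrB; apply: eq_bigr => i _; rewrite mulrzBr.
Qed.

End MatrixImage.

Theorem corollary3p3 (R : realType) (d m s t : nat)
    (G1 G2 : set 'cV[R]_d) (Q : 'M[R]_d)
    (latG1 : lattice G1)
    (subG2 : sublattice_of G2 G1)
    (indexG2 : subgroup_index G1 G2 = m)
    (OC_Q : OC G1 Q)
    (def_s : s = subgroup_index (csl G1 Q) (mximage Q G2 `&` csl G1 Q))
    (def_t : t = subgroup_index (csl G1 Q) (G2 `&` csl G1 Q)) :
  (colour_coincidence G1 G2 Q -> (Sigma G2 Q %| Sigma G1 Q)%N) /\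
  (s = t -> t = m ->
    (colour_coincidence G1 G2 Q <-> Sigma G2 Q = Sigma G1 Q)).
Proof.
have hG1 := lattice_zmod_closed latG1.
have [hG2 G21 fG2] := subG2; have [_ [hL LG1 fL]] := OC_Q.
have hQG2 := mximage_zmod_closed Q hG2.
have QG21 : mximage Q G2 `<=` mximage Q G1 by apply: image_subset.
rewrite colour_coincidenceE //; set L := csl G1 Q in def_s def_t hL LG1 fL *.
have hBL := zmod_closedI hG2 hL; have hQBL := zmod_closedI hQG2 hL.
have hK : zmod_closed (mem (csl G2 Q)) by apply: zmod_closedI.
(* Points of both [G2] and its image lie in [G1] and its image, hence in [L]. *)
have KE : csl G2 Q = (mximage Q G2 `&` L) `&` (G2 `&` L).
  apply/seteqP; split=> [x [Bx QBx]|x [[QBx Lx] [Bx _]]] //.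
  by split; split=> //; split; [apply: G21| apply: QG21|apply: G21|apply: QG21].
have fBL : finite_set (cosets L (G2 `&` L)) by apply: (finite_cosetsI hG1).
have fQBL : finite_set (cosets L (mximage Q G2 `&` L)).
  (* The ambient group is the image of [G1], which contains [L] and to which [Q] carries the
     finitely many cosets of [G2]. *)
  apply: (@finite_cosetsI _ (mximage Q G1)) => //.
  - exact: mximage_zmod_closed.
  - by move=> x [].
  - by rewrite -mximage_cosets; apply: finite_image.
have KL : csl G2 Q `<=` L by rewrite KE => x [[]].
have KB : csl G2 Q `<=` G2 by move=> x [].
have fLK : finite_set (cosets L (csl G2 Q)).
  apply: (finite_cosets_tower hL hBL) => //; first by rewrite KE => x [].
  rewrite KE; apply: (finite_cosetsI hL) => //; by move=> x [].
have fK : finite_set (cosets G1 (csl G2 Q)) by apply: (finite_cosets_tower hG1 hL).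
(* The index of [csl G2 Q] in [G1], computed through [L] and through [G2]. *)
have towers : (Sigma G1 Q * subgroup_index L (csl G2 Q) = m * Sigma G2 Q)%N.
  by rewrite -indexG2 -!subgroup_index_tower.
have S2gt0 : (0 < Sigma G2 Q)%N.
  apply: subgroup_index_gt0 => //; exact: sub_finite_set (@cosetsS _ _ _ _ G21) fK.
have S1gt0 : (0 < Sigma G1 Q)%N by apply: subgroup_index_gt0.
have t_gt0 : (0 < t)%N by rewrite def_t; apply: subgroup_index_gt0.
(* If the two subgroups agree, [csl G2 Q] is their common value and has index [t] in [L]. *)
have eqt : mximage Q G2 `&` L = G2 `&` L -> (Sigma G1 Q * t = m * Sigma G2 Q)%N.
  by move=> e; rewrite -towers KE e setIid def_t.
split=> [/eqt e|st tm].
  have : (t %| m)%N by rewrite def_t -indexG2; apply: subgroup_indexI_dvd.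
  (* The quotient of the coincidence indices is m / t: cancel [t] after substituting m = k t. *)
  move=> /dvdnP[k mE]; apply/dvdnP; exists k; apply/eqP.
  by rewrite -(eqn_pmul2r t_gt0) e mE mulnAC.
split=> [/eqt|S21]; first by rewrite tm mulnC => /eqP; rewrite eqn_pmul2l -?tm // => /eqP.
have LK : subgroup_index L (csl G2 Q) = m.
  by apply/eqP; rewrite -(eqn_pmul2l S1gt0) towers S21 mulnC.
(* [csl G2 Q] has index [m] in [L] and lies in two subgroups of the same index, as s = t = m; hence
   it equals each of them. *)
have <- : csl G2 Q = mximage Q G2 `&` L.
  apply: (subgroup_index_inj hL) => //; first by rewrite KE => x [].
  by rewrite LK -tm -st.
apply: (subgroup_index_inj hL) => //; first by rewrite KE => x [].
by rewrite LK -tm.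
Qed.
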